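(* For every commutative monoid $M$, the pair $\big((FM,\mathbf{f}),\ u_M\colon M\to (FM,+,0)\big)$ is an initial object in the comma category $M/U$, where $U\colon \mathsf{CRig}^{\circlearrowleft}\to\mathsf{CMon}$ is the forgetful functor from commutative rigs with a self-map to commutative monoids.
   Context: Rigs: a rig is a set $R$ with a commutative monoid structure $(R,+,0)$ and a monoid structure $(R,\cdot,1)$ such that $\cdot$ distributes over $+$ and $0\lambda=\lambda 0=0$ for all $\lambda\in R$; it is commutative if $\cdot$ is commutative. A rig homomorphism preserves $+,0,\cdot,1$. $\mathsf{CMon}$ is the category of commutative monoids and monoid homomorphisms. $\mathsf{CRig}^{\circlearrowleft}$ is the category of commutative rigs with a self-map: an object is a pair $(R,\mathbf{f})$ with $R$ a commutative rig and $\mathbf{f}\colon R\to R$ an arbitrary function; a morphism $(R,\mathbf{f})\to(R',\mathbf{f}')$ is a rig homomorphism $u\colon R\to R'$ with $u\circ\mathbf{f}=\mathbf{f}'\circ u$. The forgetful functor is $U(R,\mathbf{f})=(R,+,0)$, $U(u)=u$. Objects of the comma category $M/U$ are pairs $\big((R,\mathbf{f}),\phi\colon M\to U(R,\mathbf{f})\big)$ with $(R,\mathbf{f})\in\mathsf{CRig}^{\circlearrowleft}$ and $\phi$ a monoid homomorphism; a morphism from $((R,\mathbf{f}),\phi)$ to $((S,\mathbf{g}),\psi)$ is a morphism $u\colon(R,\mathbf{f})\to(S,\mathbf{g})$ in $\mathsf{CRig}^{\circlearrowleft}$ with $U(u)\circ\phi=\psi$. Construction of $FM$: for a commutative monoid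 $(M,+,0)$, let $F_0M$ be the set of formal expressions freely generated inductively by: $0$; $1$; $x_m$ for each $m\in M$; $(a+b)$ and $(ab)$ for $a,b\in F_0M$; $f(a)$ for $a\in F_0M$. Let $\sim$ be the smallest equivalence relation on $F_0M$ such that for all $a,b,c\in F_0M$ and $m,n\in M$: $((a+b)+c)\sim(a+(b+c))$; $(a+0)\sim a$; $(a+b)\sim(b+a)$; $((ab)c)\sim(a(bc))$; $(a1)\sim a$; $(ab)\sim(ba)$; $((a+b)c)\sim((ac)+(bc))$; $(0a)\sim 0$; $x_0\sim 0$; $(x_m+x_n)\sim x_{m+n}$; and $a\sim b$ implies $(a+c)\sim(b+c)$, $(ac)\sim(bc)$ and $f(a)\sim f(b)$. Set $FM:=F_0M/\sim$, with $[a]$ the class of $a$. $FM$ is a commutative rig with $[a]+[b]:=[(a+b)]$, $[a][b]:=[(ab)]$, zero $[0]$, unit $[1]$, and has the self-map $\mathbf{f}([a]):=[f(a)]$. The monoid homomorphism $u_M\colon M\to FM$ is $u_M(m):=[x_m]$. *)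

(* Defs.v *)
From HB Require Import structures.
From mathcomp Require Import all_boot all_algebra.
From mathcomp Require Import boolp.

Set Implicit Arguments.
Unset Strict Implicit.
Unset Printing Implicit Defensive.

Import GRing.Theory.
Local Open Scope ring_scope.
Local Open Scope quotient_scope.

Record category := Category {
  obj :> Type;
  hom : obj -> obj -> Type;
  idm : forall A, hom A A;
  comp : forall A B C, hom B C -> hom A B -> hom A C;
  comp_idl : forall A B (f : hom A B), comp (idm B) f = f;
  comp_idr : forall A B (f : hom A B), comp f (idm A) = f;
  comp_assoc : forall A B C D (h : hom C D) (g : hom B C) (f : hom A B),
    comp h (comp g f) = comp (comp h g) f
}.
Arguments hom {c}.
Arguments idm {c}.
Arguments comp {c A B C}.

Record functor (C D : category) := Functor {
  fobj :> C -> D;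
  fmap : forall A B : C, hom A B -> hom (fobj A) (fobj B);
  fmap_id : forall A : C, fmap (idm A) = idm (fobj A);
  fmap_comp : forall (A B E : C) (g : hom B E) (f : hom A B),
    fmap (comp g f) = comp (fmap g) (fmap f)
}.
Arguments fmap {C D} f0 {A B}.

Definition is_initial (C : category) (I : C) : Prop :=
  forall X : C, exists! h : hom I X, True.
Arguments is_initial : clear implicits.

Section Comma.
Variables (C D : category) (M : D) (U : functor C D).

Record comma_obj := CommaObj {
  comma_cod : C;
  comma_arr : hom M (U comma_cod)
}.

Record comma_hom (X Y : comma_obj) := CommaHom {
  comma_mor : hom (comma_cod X) (comma_cod Y);
  comma_tri : comp (fmap U comma_mor) (comma_arr X) = comma_arr Y
}.

Lemma comma_hom_eq X Y (u v : comma_hom X Y) :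
  comma_mor u = comma_mor v -> u = v.
Proof.
case: u v => [u pu] [v pv] /= uv; case: _ / uv in pv *.
by congr CommaHom; exact: Prop_irrelevance.
Qed.

Lemma comma_id_tri X :
  comp (fmap U (idm (comma_cod X))) (comma_arr X) = comma_arr X.
Proof. by rewrite fmap_id comp_idl. Qed.

Lemma comma_comp_tri X Y Z (v : comma_hom Y Z) (u : comma_hom X Y) :
  comp (fmap U (comp (comma_mor v) (comma_mor u))) (comma_arr X) =
  comma_arr Z.
Proof. by rewrite fmap_comp -comp_assoc !comma_tri. Qed.

Definition comma : category.
Proof.
refine (@Category comma_obj comma_hom
  (fun X => CommaHom (comma_id_tri X))
  (fun X Y Z v u => CommaHom (comma_comp_tri v u)) _ _ _) => *;
  apply: comma_hom_eq => /=.
- exact: comp_idl.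
- exact: comp_idr.
- exact: comp_assoc.
Defined.
End Comma.

Lemma additive_eq (M N : nmodType) (f g : {additive M -> N}) :
  f =1 g -> f = g.
Proof.
case: f g => [f [[pf]]] [g [[pg]]] /= /funext fg.
by case: _ / fg in pg *; rewrite (Prop_irrelevance pf pg).
Qed.

Lemma rmorphism_eq (R S : pzSemiRingType) (f g : {rmorphism R -> S}) :
  f =1 g -> f = g.
Proof.
case: f g => [f [[pf] [qf]]] [g [[pg] [qg]]] /= /funext fg.
case: _ / fg in pg qg *.
by rewrite (Prop_irrelevance pf pg) (Prop_irrelevance qf qg).
Qed.

(* [nmodType] and [comPzSemiRingType] bundle a [choiceType] structure, which is
   no restriction: by [gen_eqMixin] and [gen_choiceMixin] (classically) every
   type carries one, and morphisms ignore it.  "Pz" allows 1 = 0. *)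
Definition CMon : category.
Proof.
refine (@Category nmodType (fun M N => {additive M -> N})
  (fun M => idfun) (fun M N P g f => g \o f) _ _ _) => *;
  exact: additive_eq.
Defined.

Record rigSelfmap := RigSelfmap {
  rig :> comPzSemiRingType;
  selfmap : rig -> rig
}.

Record rigSelfmap_hom (R S : rigSelfmap) := RigSelfmapHom {
  rig_hom :> {rmorphism R -> S};
  rig_homP : forall x, rig_hom (selfmap x) = selfmap (rig_hom x)
}.

Lemma rigSelfmap_hom_eq R S (u v : rigSelfmap_hom R S) : u =1 v -> u = v.
Proof.
case: u v => [u pu] [v pv] /= /rmorphism_eq uv; case: _ / uv in pv *.
by congr RigSelfmapHom; exact: Prop_irrelevance.
Qed.

Definition rigSelfmap_id (R : rigSelfmap) : rigSelfmap_hom R R :=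
  @RigSelfmapHom R R idfun (fun=> erefl).

Lemma rigSelfmap_compP R S T (v : rigSelfmap_hom S T)
    (u : rigSelfmap_hom R S) :
  forall x, (v \o u) (selfmap x) = selfmap ((v \o u) x).
Proof. by move=> x /=; rewrite !rig_homP. Qed.

Definition rigSelfmap_comp R S T (v : rigSelfmap_hom S T)
    (u : rigSelfmap_hom R S) : rigSelfmap_hom R T :=
  @RigSelfmapHom R T (v \o u) (rigSelfmap_compP v u).

Definition CRigSelfmap : category.
Proof.
refine (@Category rigSelfmap rigSelfmap_hom
  rigSelfmap_id rigSelfmap_comp _ _ _) => *; exact: rigSelfmap_hom_eq.
Defined.

Definition forget : functor CRigSelfmap CMon.
Proof.
refine (@Functor CRigSelfmap CMon
  (fun R => rig R : nmodType)
  (fun R S u => rig_hom u : {additive R -> S}) _ _) => *;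
  exact: additive_eq.
Defined.

Inductive expr (M : Type) : Type :=
| Zero
| One
| Var of M
| Add of expr M & expr M
| Mul of expr M & expr M
| App of expr M.
Arguments Zero {M}.
Arguments One {M}.

HB.instance Definition _ (M : Type) := gen_eqMixin (expr M).
HB.instance Definition _ (M : Type) := gen_choiceMixin (expr M).

(* Congruence is required on the left argument only; the other side follows from
   commutativity, see [add_congr] and [mul_congr]. *)
Inductive expr_eq (M : nmodType) : expr M -> expr M -> Prop :=
| ee_refl a : expr_eq a a
| ee_sym a b : expr_eq a b -> expr_eq b a
| ee_trans a b c : expr_eq a b -> expr_eq b c -> expr_eq a c
| ee_addA a b c : expr_eq (Add (Add a b) c) (Add a (Add b c))
| ee_add0 a : expr_eq (Add a Zero) a
| ee_addC a b : expr_eq (Add a b) (Add b a)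
| ee_mulA a b c : expr_eq (Mul (Mul a b) c) (Mul a (Mul b c))
| ee_mul1 a : expr_eq (Mul a One) a
| ee_mulC a b : expr_eq (Mul a b) (Mul b a)
| ee_mulDl a b c : expr_eq (Mul (Add a b) c) (Add (Mul a c) (Mul b c))
| ee_mul0 a : expr_eq (Mul Zero a) Zero
| ee_var0 : expr_eq (Var 0) Zero
| ee_varD m n : expr_eq (Add (Var m) (Var n)) (Var (m + n))
| ee_add_congr a b c : expr_eq a b -> expr_eq (Add a c) (Add b c)
| ee_mul_congr a b c : expr_eq a b -> expr_eq (Mul a c) (Mul b c)
| ee_app_congr a b : expr_eq a b -> expr_eq (App a) (App b).

Section FreeRig.
Variable M : nmodType.

Definition expr_eqb (a b : expr M) : bool := `[< expr_eq a b >].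

Lemma expr_eqb_refl : reflexive expr_eqb.
Proof. by move=> a; apply/asboolP; exact: ee_refl. Qed.

Lemma expr_eqb_sym : symmetric expr_eqb.
Proof. by move=> a b; apply/asboolP/asboolP; exact: ee_sym. Qed.

Lemma expr_eqb_trans : transitive expr_eqb.
Proof.
move=> b a c /asboolP ab /asboolP bc.
by apply/asboolP; exact: ee_trans bc.
Qed.

Canonical expr_equiv :=
  EquivRel expr_eqb expr_eqb_refl expr_eqb_sym expr_eqb_trans.

Definition FM : Type := {eq_quot expr_equiv}.
HB.instance Definition _ := Choice.on FM.
HB.instance Definition _ := EqQuotient.on FM.

Definition cls (a : expr M) : FM := \pi_FM a.

Lemma clsP (a b : expr M) : cls a = cls b <-> expr_eq a b.
Proof. by split=> [/eqquotP/asboolP|?] //; apply/eqquotP/asboolP. Qed.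

Lemma repr_cls (a : expr M) : expr_eq (repr (cls a)) a.
Proof. by apply/clsP; rewrite /cls reprK. Qed.

Lemma cls_ind (P : FM -> Prop) : (forall a, P (cls a)) -> forall x, P x.
Proof. by move=> H x; rewrite -[x]reprK; exact: H. Qed.

Lemma add_congr (a a' b b' : expr M) :
  expr_eq a a' -> expr_eq b b' -> expr_eq (Add a b) (Add a' b').
Proof.
move=> aa bb; apply: ee_trans (ee_add_congr _ aa) _.
apply: ee_trans (ee_addC _ _) _.
by apply: ee_trans (ee_add_congr _ bb) (ee_addC _ _).
Qed.

Lemma mul_congr (a a' b b' : expr M) :
  expr_eq a a' -> expr_eq b b' -> expr_eq (Mul a b) (Mul a' b').
Proof.
move=> aa bb; apply: ee_trans (ee_mul_congr _ aa) _.
apply: ee_trans (ee_mulC _ _) _.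
by apply: ee_trans (ee_mul_congr _ bb) (ee_mulC _ _).
Qed.

(* The lemmas [cls_add], [cls_mul] and [cls_app] below show that these
   operations do not depend on the chosen representatives. *)
Definition FM_add (x y : FM) : FM := cls (Add (repr x) (repr y)).
Definition FM_mul (x y : FM) : FM := cls (Mul (repr x) (repr y)).
Definition FM_app (x : FM) : FM := cls (App (repr x)).

Lemma cls_add a b : FM_add (cls a) (cls b) = cls (Add a b).
Proof. by apply/clsP/add_congr; exact: repr_cls. Qed.

Lemma cls_mul a b : FM_mul (cls a) (cls b) = cls (Mul a b).
Proof. by apply/clsP/mul_congr; exact: repr_cls. Qed.

Lemma cls_app a : FM_app (cls a) = cls (App a).
Proof. by apply/clsP/ee_app_congr; exact: repr_cls. Qed.

Lemma FM_addA : associative FM_add.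
Proof.
elim/cls_ind=> a; elim/cls_ind=> b; elim/cls_ind=> c.
by rewrite !cls_add; apply/clsP/ee_sym/ee_addA.
Qed.

Lemma FM_addC : commutative FM_add.
Proof.
elim/cls_ind=> a; elim/cls_ind=> b.
by rewrite !cls_add; apply/clsP/ee_addC.
Qed.

Lemma FM_add0 : left_id (cls Zero) FM_add.
Proof. by elim/cls_ind=> a; rewrite FM_addC cls_add; apply/clsP/ee_add0. Qed.

Lemma FM_mulA : associative FM_mul.
Proof.
elim/cls_ind=> a; elim/cls_ind=> b; elim/cls_ind=> c.
by rewrite !cls_mul; apply/clsP/ee_sym/ee_mulA.
Qed.

Lemma FM_mulC : commutative FM_mul.
Proof.
elim/cls_ind=> a; elim/cls_ind=> b.
by rewrite !cls_mul; apply/clsP/ee_mulC.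
Qed.

Lemma FM_mul1 : left_id (cls One) FM_mul.
Proof. by elim/cls_ind=> a; rewrite FM_mulC cls_mul; apply/clsP/ee_mul1. Qed.

Lemma FM_mulDl : left_distributive FM_mul FM_add.
Proof.
elim/cls_ind=> a; elim/cls_ind=> b; elim/cls_ind=> c.
by rewrite !(cls_add, cls_mul); apply/clsP/ee_mulDl.
Qed.

Lemma FM_mul0 : left_zero (cls Zero) FM_mul.
Proof. by elim/cls_ind=> a; rewrite cls_mul; apply/clsP/ee_mul0. Qed.

HB.instance Definition _ := GRing.isNmodule.Build FM FM_addA FM_addC FM_add0.
HB.instance Definition _ := GRing.Nmodule_isComPzSemiRing.Build FM
  FM_mulA FM_mulC FM_mul1 FM_mulDl FM_mul0.

Definition uM (m : M) : FM := cls (Var m).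

Lemma uM_nmod_morphism : nmod_morphism uM.
Proof.
split=> [|m n]; first by apply/clsP/ee_var0.
by rewrite -[RHS]/(FM_add _ _) cls_add; apply/clsP/ee_sym/ee_varD.
Qed.

HB.instance Definition _ := GRing.isNmodMorphism.Build M FM uM uM_nmod_morphism.

End FreeRig.

Definition FM_rig (M : nmodType) : CRigSelfmap :=
  @RigSelfmap (FM M) (@FM_app M).

Definition FM_comma (M : nmodType) : comma (M : CMon) forget :=
  @CommaObj CRigSelfmap CMon M forget (FM_rig M) (@uM M : {additive M -> FM M}).

(* Main.v *)
From HB Require Import structures.
From mathcomp Require Import all_boot all_algebra.
Require Import Defs.

(** A monoid homomorphism [phi : M -> R] into a commutative rig with a self-map
    interprets every formal expression in [R]: read [Var m] as [phi m] and each
    formal operation as the operation of [R].  Each generating relation of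
    [expr_eq] is either an axiom of commutative rigs, a consequence of the
    additivity of [phi], or a closure condition that every equality satisfies,
    so the interpretation is constant on classes ([eval_expr_eq]).
    It therefore descends to [FM M] ([lift]), and the descended map preserves
    the operations because those of [FM M] are the formal ones on
    representatives.  Uniqueness holds since [FM M] is generated by the elements
    [uM m] under the rig operations and the self-map: two morphisms that agree
    on them agree on all classes, by induction on expressions
    ([rigSelfmap_hom_FM_ext]). *)

Set Implicit Arguments.
Unset Strict Implicit.
Unset Printing Implicit Defensive.

Import GRing.Theory.
Local Open Scope ring_scope.

(** * Interpretation of expressions and existence *)

Section Lift.
Variables (M : nmodType) (R : rigSelfmap) (phi : {additive M -> R}).

Fixpoint eval (a : expr M) : R :=
  match a with
  | Zero => 0
  | One => 1
  | Var m => phi m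
  | Add a b => eval a + eval b
  | Mul a b => eval a * eval b
  | App a => selfmap (eval a)
  end.

(** Equality after evaluation is itself an equivalence relation with all the
    closure properties that define [expr_eq], which is the smallest one. *)
Lemma eval_expr_eq (a b : expr M) : expr_eq a b -> eval a = eval b.
Proof.
elim=> {a b} //=.
- by move=> a b c _ -> _ ->.
- by move=> a b c; rewrite addrA.
- by move=> a; rewrite addr0.
- by move=> a b; rewrite addrC.
- by move=> a b c; rewrite mulrA.
- by move=> a; rewrite mulr1.
- by move=> a b; rewrite mulrC.
- by move=> a b c; rewrite mulrDl.
- by move=> a; rewrite mul0r.
- by rewrite raddf0.
- by move=> m n; rewrite raddfD.
- by move=> a b c _ ->.
- by move=> a b c _ ->.
- by move=> a b _ ->.
Qed.

Definition lift (x : FM M) : R := eval (repr x).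

Lemma lift_cls (a : expr M) : lift (cls a) = eval a.
Proof. exact/eval_expr_eq/repr_cls. Qed.

Lemma lift_nmod_morphism : nmod_morphism lift.
Proof. by split=> [|x y]; exact: lift_cls. Qed.

Lemma lift_monoid_morphism : monoid_morphism lift.
Proof. by split=> [|x y]; exact: lift_cls. Qed.

HB.instance Definition _ :=
  GRing.isNmodMorphism.Build (FM M) R lift lift_nmod_morphism.
HB.instance Definition _ :=
  GRing.isMonoidMorphism.Build (FM M) R lift lift_monoid_morphism.

Lemma lift_selfmap (x : FM M) : lift (FM_app x) = selfmap (lift x).
Proof. exact: lift_cls. Qed.

Definition lift_hom : rigSelfmap_hom (FM_rig M) R :=
  @RigSelfmapHom (FM_rig M) R lift lift_selfmap.

Lemma lift_uM (m : M) : lift (uM m) = phi m.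
Proof. exact: lift_cls. Qed.

End Lift.

(** * Generation by the image of [uM] and uniqueness *)

(** Induction on expressions transported to classes, so that morphisms out of
    [FM M] can be compared without mentioning representatives. *)
Lemma FM_ind (M : nmodType) (P : FM M -> Prop) :
  P 0 -> P 1 -> (forall m, P (uM m)) ->
  (forall x y, P x -> P y -> P (x + y)) ->
  (forall x y, P x -> P y -> P (x * y)) ->
  (forall x, P x -> P (FM_app x)) ->
  forall x, P x.
Proof.
move=> P0 P1 Pu PD PM Pf; apply: cls_ind.
elim=> [||m|a Pa b Pb|a Pa b Pb|a Pa] //.
- exact: Pu.
- by rewrite -cls_add; exact: PD.
- by rewrite -cls_mul; exact: PM.
- by rewrite -cls_app; exact: Pf.
Qed.

Lemma rigSelfmap_hom_FM_ext (M : nmodType) (R : rigSelfmap)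
    (u v : rigSelfmap_hom (FM_rig M) R) :
  (forall m : M, u (uM m) = v (uM m)) -> u = v.
Proof.
move=> uv; apply: rigSelfmap_hom_eq; apply: FM_ind => //.
- by rewrite !rmorph0.
- by rewrite !rmorph1.
- by move=> x y ux uy; rewrite !rmorphD ux uy.
- by move=> x y ux uy; rewrite !rmorphM ux uy.
- move=> x ux; rewrite -[FM_app x]/(@selfmap (FM_rig M) x).
  by rewrite !rig_homP ux.
Qed.

(** * Initiality *)

Theorem proposition3p7 (M : CMon) :
  is_initial (comma M forget) (FM_comma M).
Proof.
move=> [R phi].
have tri : @comp CMon _ _ _ (fmap forget (lift_hom phi : @hom CRigSelfmap _ _))
    (comma_arr (FM_comma M)) = phi.
  by apply: additive_eq => m; exact: lift_uM.
exists (@CommaHom CRigSelfmap CMon M forget (FM_comma M) (CommaObj phi)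
  (lift_hom phi) tri); split=> // -[u utri] _.
apply: comma_hom_eq; apply: rigSelfmap_hom_FM_ext => m.
(* [utri] equates arrows of [CMon]; the cast exposes them as additive maps, so
   that they can be applied to [m]. *)
have /= := congr1 (fun h : {additive (M : nmodType) -> rig R} => h m) utri.
by move=> um; rewrite [LHS]lift_uM; exact: esym um.
Qed.
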